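(* $\mathbb{E}_1$ is not Borel weakly compact.
   Context: $\mathbb{E}_1$ is the equivalence relation on $(2^{\omega})^{\omega}$ given by $\bar{x} \mathrel{\mathbb{E}_1} \bar{y}$ iff $x_n=y_n$ for all but finitely many $n$. For equivalence relations $E$, $F$ on $X$, $Y$, $E\leq_B F$ means there is a Borel map $\varphi: X\to Y$ with $x_1 \mathrel{E} x_2 \Leftrightarrow \varphi(x_1) \mathrel{F} \varphi(x_2)$. $E\upharpoonright A$ denotes the restriction of $E$ to $A$. A Borel equivalence relation $E$ on a Polish space $X$ is Borel weakly compact if for every symmetric $E\times E$-invariant Borel function $f: X^2\to 2$ (i.e. $f(x,y)=f(y,x)$, and $f(x,y)=f(x',y')$ whenever $x \mathrel{E} x'$ and $y \mathrel{E} y'$) there is a Borel set $A\subseteq X$ with $E\leq_B E\upharpoonright A$ such that $f$ is constant on $A^2\setminus E$. *)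

(* Defs.v *)
From mathcomp Require Import all_boot all_order all_algebra.
From mathcomp Require Import all_classical all_reals all_analysis.

Set Implicit Arguments.
Unset Strict Implicit.
Unset Printing Implicit Defensive.

Local Open Scope classical_set_scope.

Definition borel_set (X : topologicalType) : set (set X) := <<s @open X >>.

Definition borel_map (X Y : topologicalType) (phi : X -> Y) : Prop :=
  forall B : set Y, borel_set B -> borel_set (phi @^-1` B).

Definition borel_reducible (X Y : topologicalType)
    (E : X -> X -> Prop) (F : Y -> Y -> Prop) : Prop :=
  exists phi : X -> Y,
    borel_map phi /\ forall x1 x2 : X, E x1 x2 <-> F (phi x1) (phi x2).

Definition borel_equivalence (X : topologicalType) (E : X -> X -> Prop) : Prop :=
  [/\ forall x, E x x,
      forall x y, E x y -> E y x,
      forall x y z, E x y -> E y z -> E x z &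
      borel_set [set p : X * X | E p.1 p.2]].

(* [set_type A] carries the subspace topology. *)
Definition restr_rel (X : topologicalType) (E : X -> X -> Prop) (A : set X) :
    set_type A -> set_type A -> Prop :=
  fun x y => E (set_val x) (set_val y).

(* The notion is meant for a Borel equivalence relation [E] on a Polish space
   [X]; these are standing assumptions on the arguments and not part of the
   property, so that its negation does not hold by their failure. *)
Definition borel_weakly_compact (X : topologicalType) (E : X -> X -> Prop) :
    Prop :=
  forall f : X * X -> bool,
    borel_map f ->
    (forall x y, f (x, y) = f (y, x)) ->
    (forall x x' y y', E x x' -> E y y' -> f (x, y) = f (x', y')) ->
    exists A : set X,
      [/\ borel_set A,
          borel_reducible E (@restr_rel X E A) &
          exists c : bool,
            forall x y, A x -> A y -> ~ E x y -> f (x, y) = c].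

(* [prod_topology] is the product topology, so this is (2^omega)^omega. *)
Definition cantor_seq : topologicalType :=
  prod_topology (fun _ : nat => cantor_space).

Definition E1 (x y : cantor_seq) : Prop := finite_set [set n | x n <> y n].

Lemma borel_set_bigcup (X : topologicalType) (F : nat -> set X) :
  (forall n, borel_set (F n)) -> borel_set (\bigcup_n F n).
Proof. exact: sigma_algebra_bigcup. Qed.

Lemma borel_set_setC (X : topologicalType) (A : set X) :
  borel_set A -> borel_set (~` A).
Proof. by move=> ?; rewrite -setTD; exact: sigma_algebraCD. Qed.

Lemma borel_set_open (X : topologicalType) (A : set X) :
  open A -> borel_set A.
Proof. exact: sub_sigma_algebra. Qed.

Lemma E1_borel_equivalence : borel_equivalence E1.
Proof.
split.
- move=> x; rewrite /E1 (_ : [set n | _] = set0) //.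
  by apply/seteqP; split=> n //= /(_ erefl).
- move=> x y; rewrite /E1 => h; apply: sub_finite_set h => n /= xy yx.
  exact/xy/esym.
- move=> x y z h1 h2.
  have h : finite_set ([set n | x n <> y n] `|` [set n | y n <> z n]).
    by rewrite finite_setU.
  apply: sub_finite_set h => n /= xz.
  by have [xy|xy] := pselect (x n = y n); [right; rewrite -xy|left].
pose D n m : set (cantor_seq * cantor_seq) := [set p | p.1 n m <> p.2 n m].
have Dopen n m : open (D n m).
  have ce : continuous (fun x : cantor_seq => x n m : bool).
    move=> x; have c1 : continuous (fun x : cantor_seq => x n).
      exact: (@proj_continuous nat (fun _ => cantor_space) n).
    have c2 : continuous (fun y : cantor_space => y m : bool).
      exact: (@proj_continuous nat (fun _ => bool) m).
    exact: (continuous_comp (c1 x) (c2 (x n))).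
  have oe b : open [set x : cantor_seq | x n m = b].
    apply: (@open_comp _ _ (fun x : cantor_seq => x n m : bool) [set b]).
      by move=> x _; exact: ce.
    exact: discrete_open.
  rewrite openE => -[x y] /= xy.
  exists ([set z | z n m = x n m], [set z | z n m = y n m]).
    by split; apply: open_nbhs_nbhs; split => //; exact: oe.
  by move=> [? ?] /= [xE yE]; rewrite /D /= xE yE.
have -> : [set p : cantor_seq * cantor_seq | E1 p.1 p.2] =
    \bigcup_N ~` (\bigcup_k \bigcup_m D (N + k)%N m).
  apply/seteqP; split=> -[x y] /=; last first.
    move=> [N _ /= h]; apply: (sub_finite_set _ (finite_II N)) => n /= xy.
    rewrite ltnNge; apply/negP => Nn; apply: h; exists (n - N)%N => //.
    apply: contrapT => h; apply: xy; apply/funext => m.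
    by apply: contrapT => xym; apply: h; exists m => //; rewrite /D /= subnKC.
  move=> /finite_seqP [S HS].
  exists (\max_(i <- S) i).+1 => //= -[k _ [m _]]; rewrite /D /= => xy.
  set n := (_ + k)%N in xy.
  have : [set` S] n by rewrite -HS /= => xyn; apply: xy; rewrite xyn.
  move=> /= /(@leq_bigmax_seq _ S predT id n) /(_ isT).
  by rewrite /n /= addSn ltnNge leq_addr.
apply: borel_set_bigcup => N; apply: borel_set_setC.
apply: borel_set_bigcup => k; apply: borel_set_bigcup => m.
exact: borel_set_open (Dopen _ _).
Qed.

(* Main.v *)
Require Import Defs.
From mathcomp Require Import all_boot.
From mathcomp Require Import all_classical all_analysis.
From mathcomp Require Import zify.

(* For a pair (x, y) and q, let (r, k), with q <= r, be the place where x and y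
   differ that minimizes r + k, then r; call x_r(k) the sign at q and r + k + 1 the jump
   of q. Colour (x, y) by whether almost every q leads, by iterated jumps, to a
   point whose sign differs from the sign at its jump. Let phi be a Borel
   reduction of E1 to E1 restricted to A. On a comeager set G invariant under
   flipping finitely many bits, phi is continuous, and the rows of phi(w)
   changed by a given flip are locally bounded. Moreover, for generic w, flips
   of a single bit of a single row k of w change phi(w) only in boundedly many
   rows, but beyond any given row for infinitely many bits of a suitable k.
   Hence the images of pairs (u, v) with v a finite modification of u can be
   altered by arbitrarily small amounts in a new block of rows, so that the
   jumps of all points of the previous block land in the new one. Interchanging the roles of u and v in the new block
   reverses the signs there and nothing before. In the limit one gets pairs of
   inequivalent points of A of both colours: one where the signs are constant
   along a chain of jumps, and one where along each chain they change. *)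

Set Implicit Arguments.
Unset Strict Implicit.
Unset Printing Implicit Defensive.

Local Open Scope classical_set_scope.
Local Open Scope nat_scope.

(** * Finite agreement, equality of tails and finite modifications *)

Definition bits := nat -> nat -> bool.

(** The [l] by [l] squares give a neighbourhood base of the product topology, so openness and
    continuity are expressed through this relation alone. *)
Definition agree (l : nat) (x y : bits) : Prop :=
  forall n m, n < l -> m < l -> x n m = y n m.

Definition eqfrom (N : nat) (x y : bits) : Prop :=
  forall n m, N <= n -> x n m = y n m.

(** Counting parity makes concatenation act as composition; lists keep the family of modifications
    countable, as category arguments require. *)
Definition flip (g : seq (nat * nat)) (x : bits) : bits :=
  fun n m => x n m (+) odd (count_mem (n, m) g).

Lemma agree_sym l x y : agree l x y -> agree l y x.
Proof. by move=> h n m nl ml; rewrite h. Qed.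

Lemma agree_trans l x y z : agree l x y -> agree l y z -> agree l x z.
Proof. by move=> h1 h2 n m nl ml; rewrite h1 ?h2. Qed.

Lemma agree_le l l' x y : l <= l' -> agree l' x y -> agree l x y.
Proof. by move=> ll h n m nl ml; apply: h; apply: leq_trans ll. Qed.

Lemma eqfrom_sym N x y : eqfrom N x y -> eqfrom N y x.
Proof. by move=> h n m nl; rewrite h. Qed.

Lemma eqfrom_trans N x y z : eqfrom N x y -> eqfrom N y z -> eqfrom N x z.
Proof. by move=> h1 h2 n m nl; rewrite h1 ?h2. Qed.

Lemma eqfrom_le N N' x y : N <= N' -> eqfrom N x y -> eqfrom N' x y.
Proof. by move=> NN h n m nl; apply: h; apply: leq_trans nl. Qed.

Lemma E1P (x y : cantor_seq) : E1 x y <-> exists N, eqfrom N x y.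
Proof.
split=> [/finite_seqP[S HS]|[N h]].
  exists (\max_(i <- S) i).+1 => n m; apply: contraTeq => xy.
  have : [set` S] n by rewrite -HS /= => xyn; rewrite xyn eqxx in xy.
  by move=> /= /(@leq_bigmax_seq _ S predT id n) /(_ isT); rewrite -ltnNge.
apply: (sub_finite_set _ (finite_II N)) => n /= xy.
by rewrite ltnNge; apply/negP => Nn; apply/xy/funext => m; exact: h.
Qed.

Lemma flip_cat g h x : flip (g ++ h) x = flip g (flip h x).
Proof.
by apply/funext => n; apply/funext => m; rewrite /flip count_cat oddD addbA addbAC.
Qed.

Lemma flipK g : involutive (flip g).
Proof. by move=> x; apply/funext => n; apply/funext => m; rewrite /flip addbK. Qed.

Lemma flip0 x : flip [::] x = x.
Proof. by apply/funext => n; apply/funext => m; rewrite /flip addbF. Qed.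

Lemma flip1E k e x n m :
  flip [:: (k, e)] x n m = x n m (+) ((n == k) && (m == e)).
Proof. by rewrite /flip /= addn0 xpair_eqE oddb [k == _]eq_sym [e == _]eq_sym. Qed.

Lemma agree_flip l g x y : agree l x y -> agree l (flip g x) (flip g y).
Proof. by move=> h n m nl ml; rewrite /flip h. Qed.

Lemma agree_flip1 l k e x : l <= e -> agree l x (flip [:: (k, e)] x).
Proof.
by move=> le n m nl ml; rewrite flip1E (ltn_eqF (leq_trans ml le)) andbF addbF.
Qed.

(** * Baire category *)

Definition open_dense (W : bits -> Prop) : Prop :=
  (forall w, W w -> exists l, forall y, agree l w y -> W y) /\
  (forall w l, exists2 y, agree l w y & W y).

(** Equality with a dense $G_\delta$ set, not mere inclusion: [fusion] uses that every point of [G]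
    lies in each [W i]. *)
Definition residual (G : bits -> Prop) : Prop :=
  exists W : nat -> bits -> Prop,
    (forall i, open_dense (W i)) /\ (forall w, G w <-> forall i, W i w).

Lemma open_dense_flip W g : open_dense W -> open_dense (fun w => W (flip g w)).
Proof.
move=> [Wo Wd]; split=> [w /Wo[l hl]|w l].
  by exists l => y wy; apply/hl/agree_flip.
have [y wy Wy] := Wd (flip g w) l; exists (flip g y); last by rewrite flipK.
by rewrite -(flipK g w); exact: agree_flip.
Qed.

Lemma residual_open_dense W : open_dense W -> residual W.
Proof. by move=> hW; exists (fun=> W); split => // w; split=> // /(_ 0). Qed.

Lemma residual_forall (J : countType) (F : J -> bits -> Prop) :
  (forall j, residual (F j)) -> residual (fun w => forall j, F j w).
Proof.
move=> /choice[W hW].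
(* Codes of no pair get the whole space, which is open and dense. *)
exists (fun n => if unpickle n is Some (j, i) then W j i else fun=> True).
split=> [n|w].
  case: unpickle => [[j i]|]; first by case: (hW j).
  by split=> [w _|w l]; [exists 0|exists w].
split=> [Fw n|h j]; first by case: unpickle => // -[j i]; exact: ((hW j).2 w).1.
by apply/(hW j).2 => i; have := h (pickle (j, i)); rewrite pickleK.
Qed.

Lemma residual_flip G : residual G -> residual (fun w => forall g, G (flip g w)).
Proof.
move=> [W [hW GW]]; apply: residual_forall => g.
exists (fun i w => W i (flip g w)); split=> [i|w]; first exact: open_dense_flip.
exact: GW.
Qed.

Lemma residualI G H : residual G -> residual H -> residual (fun w => G w /\ H w).
Proof.
move=> rG rH; have := @residual_forall bool (fun b => if b then G else H).
case=> [[]//|W [hW GW]]; exists W; split=> // w; rewrite -GW.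
by split=> [[Gw Hw] []//|h]; split; [exact: (h true)|exact: (h false)].
Qed.

Lemma limit_agree (w : nat -> bits) (l : nat -> nat) :
  (forall i, l i < l i.+1) -> (forall i, agree (l i) (w i) (w i.+1)) ->
  exists y, forall i, agree (l i) (w i) y.
Proof.
move=> lS wS.
have li i : i <= l i by elim: i => // i ih; exact: leq_ltn_trans ih (lS i).
have lmono i d : l i <= l (i + d).
  elim: d => [|d ih]; first by rewrite addn0.
  by rewrite addnS; apply: leq_trans ih (ltnW (lS _)).
have wD i d : agree (l i) (w i) (w (i + d)).
  elim: d => [|d ih]; first by rewrite addn0.
  by rewrite addnS; apply: agree_trans ih (agree_le (lmono i d) (wS _)).
have wle i j n m : n < l i -> m < l i -> i <= j -> w i n m = w j n m.
  by move=> nl ml ij; rewrite -(subnKC ij) (wD i (j - i)).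
(* Entry [(n, m)] is settled from stage [(maxn n m).+1] on, since [i <= l i]. *)
exists (fun n m => w (maxn n m).+1 n m) => i n m nl ml.
have h : maxn n m < l (maxn n m).+1 by exact: li.
have [im|im] := leqP i (maxn n m).+1; first exact: wle.
symmetry; apply: wle (ltnW im).
  by apply: leq_ltn_trans h; exact: leq_maxl.
by apply: leq_ltn_trans h; exact: leq_maxr.
Qed.

(** The Baire category theorem: nested basic neighbourhoods, entering the sets [W i] one after
    another, close in on a point. *)
Lemma residual_nonempty G : residual G -> exists w, G w.
Proof.
move=> [W [hW GW]].
pose R (s t : bits * nat * nat) := [/\ agree s.1.2 s.1.1 t.1.1, s.1.2 < t.1.2,
  t.2 = s.2.+1 & forall y, agree t.1.2 t.1.1 y -> W s.2 y].
have [|f [f0 fS]] := @dependent_choice _ R _ (fun _ _ => false, 0, 0).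
  move=> [[w l] i]; apply/cid; have [y wy Wy] := (hW i).2 w l.
  have [l' hl'] := (hW i).1 y Wy.
  exists (y, maxn l.+1 l', i.+1); split => //=; first exact: leq_maxl.
  by move=> z yz; apply/hl'/(agree_le _ yz); exact: leq_maxr.
have [|i|y hy] := @limit_agree (fun i => (f i).1.1) (fun i => (f i).1.2).
- by move=> i; case: (fS i).
- by case: (fS i).
have fi i : (f i).2 = i by elim: i => [|i ih]; rewrite ?f0// -[in RHS]ih; case: (fS i).
exists y; apply/GW => i; have [_ _ _ h] := fS i.
by rewrite -[i]fi; apply: h; exact: hy.
Qed.

(** * The Baire property *)

Definition rel_clopen (G B : bits -> Prop) : Prop :=
  forall w, G w -> exists l, forall y, G y -> agree l w y -> (B w <-> B y).

Lemma rel_clopenS (G H B : bits -> Prop) :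
  (forall w, H w -> G w) -> rel_clopen G B -> rel_clopen H B.
Proof. by move=> HG h w /HG/h[l hl]; exists l => y /HG; exact: hl. Qed.

(** Equivalent to the Baire property: a set that is open up to a meager set becomes relatively
    clopen once the boundary of the open set is removed too. *)
Definition baire : set (set bits) :=
  [set B | exists2 G, residual G & rel_clopen G B].

Lemma baire_open (B : set bits) :
  (forall w, B w -> exists l, forall y, agree l w y -> B y) -> baire B.
Proof.
(* [O'] is the interior of the complement; what is discarded is the boundary of [B]. *)
move=> Bo; pose O' w := exists l, forall y, agree l w y -> ~ B y.
exists (fun w => B w \/ O' w).
  apply: residual_open_dense; split=> [w [/Bo[l hl]|[l hl]]|w l].
  - by exists l => y /hl; left.
  - exists l => y wy; right; exists l => z yz; exact/hl/(agree_trans wy yz).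
  - have [[y wy By]|h] := pselect (exists2 y, agree l w y & B y).
      by exists y => //; left.
    by exists w => //; right; exists l => y wy By; apply: h; exists y.
move=> w [Bw|[l hl]]; first by have [l hl] := Bo w Bw; exists l => y _ /hl.
by exists l => y _ wy; split => [|/(hl y wy)//]; move/(hl w (fun _ _ _ _ => erefl)).
Qed.

Lemma baire_sigma_algebra : sigma_algebra setT baire.
Proof.
split.
- by apply: baire_open.
- move=> B [G rG hB]; exists G => // w Gw; have [l hl] := hB w Gw.
  by exists l => y Gy /(hl y Gy); rewrite /setD/=; tauto.
move=> B hB; have /choice[F hF] i : exists G, residual G /\ rel_clopen G (B i).
  by have [G rG hG] := hB i; exists G.
pose G w := forall i, F i w.
have rG : residual G by apply: residual_forall => i; have [] := hF i.
(* [O] is open and agrees with the union on [G], so only its boundary remains to be removed. *)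
pose O w := exists l, forall y, G y -> agree l w y -> (\bigcup_i B i) y.
pose O' w := exists l, forall y, agree l w y -> ~ O y.
have dO : open_dense (fun w => O w \/ O' w).
  split=> [w [[l hl]|[l hl]]|w l].
  - exists l => y wy; left; exists l => z Gz yz; exact/hl/(agree_trans wy yz).
  - exists l => y wy; right; exists l => z yz; exact/hl/(agree_trans wy yz).
  - have [[y wy Oy]|h] := pselect (exists2 y, agree l w y & O y).
      by exists y => //; left.
    by exists w => //; right; exists l => y wy Oy; apply: h; exists y.
exists (fun w => G w /\ (O w \/ O' w)); first exact/residualI/residual_open_dense.
have BO w : G w -> (\bigcup_i B i) w -> O w.
  move=> Gw [i _ Biw]; have [l hl] := (hF i).2 w (Gw i).
  by exists l => y Gy wy; exists i => //; apply/(hl y (Gy i) wy).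
move=> w [Gw [[l hl]|[l hl]]]; exists l => y [Gy _] wy.
  by split=> _; [exact: hl|exact: (hl w)].
split=> [/(BO _ Gw) Ow|/(BO _ Gy) Oy]; last by case: (hl y wy).
by case: (hl w).
Qed.

Lemma open_agree (U : set cantor_seq) (w : cantor_seq) :
  open U -> U w -> exists l, forall y : cantor_seq, agree l w y -> U y.
Proof.
move=> oU Uw.
pose F : set_system cantor_seq :=
  [set A | exists l, forall y, agree l w y -> A y].
have FF : Filter F.
  split=> [|A B [l hl] [l' hl']|A B AB [l hl]]; first by exists 0.
    exists (maxn l l') => y wy; split; [apply: hl|apply: hl'];
      by apply: agree_le wy; rewrite ?leq_maxl ?leq_maxr.
  by exists l => y /hl/AB.
suff : F --> w by move=> /(_ U); apply; exact: open_nbhs_nbhs.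
apply/pointwise_cvgP => n; apply/pointwise_cvgP => m B /= /nbhs_singleton Bw.
by exists (maxn n m).+1 => y wy /=; rewrite -wy// ltnS ?leq_maxl ?leq_maxr.
Qed.

Lemma borel_baire (B : set cantor_seq) : borel_set B -> baire B.
Proof.
apply: smallest_sub; first exact: baire_sigma_algebra.
by move=> U oU; apply: baire_open => w Uw; exact: open_agree.
Qed.

(** * Sigma-algebras under connectives and countable quantifiers *)

Section sigma_algebra_predicates.
Variables (T : Type) (S : set (set T)).
Hypothesis hS : sigma_algebra setT S.

Lemma sa_not (P : T -> Prop) : S [set x | P x] -> S [set x | ~ P x].
Proof.
case: hS => _ h _ /h; rewrite (_ : _ `\` _ = [set x | ~ P x])//.
by apply/seteqP; split=> x //= [].
Qed.

Lemma sa_ex (P : nat -> T -> Prop) :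
  (forall n, S [set x | P n x]) -> S [set x | exists n, P n x].
Proof.
case: hS => _ _ h /h; rewrite (_ : \bigcup_k _ = [set x | exists n, P n x])//.
by apply/seteqP; split=> x //= [n]; [move=> _ Pn|move=> Pn]; exists n.
Qed.

Lemma sa_all (P : nat -> T -> Prop) :
  (forall n, S [set x | P n x]) -> S [set x | forall n, P n x].
Proof.
move=> h; have := sa_not (sa_ex (fun n => sa_not (h n))).
rewrite (_ : [set x | ~ _] = [set x | forall n, P n x])//.
apply/seteqP; split=> x /= Px; last by move=> [n]; apply; exact: Px.
by move=> n; apply: contrapT => Pn; apply: Px; exists n.
Qed.

Lemma sa_cst (P : Prop) : S [set _ | P].
Proof.
have h0 : S [set _ | False] by case: hS.
by have [p|p] := pselect P; [have := sa_not h0; congr S|move: h0; congr S];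
  apply/seteqP; split=> x //=; tauto.
Qed.

Lemma sa_or (P Q : T -> Prop) :
  S [set x | P x] -> S [set x | Q x] -> S [set x | P x \/ Q x].
Proof.
move=> hP hQ; have /sa_ex := fun n : nat => if n is 0 as n return
  S [set x | (if n is 0 then P else Q) x] then hP else hQ.
congr S; apply/seteqP; split=> x /=; first by move=> [[|n]]; [left|right].
by move=> [Px|Qx]; [exists 0|exists 1].
Qed.

Lemma sa_imp (P Q : T -> Prop) :
  S [set x | P x] -> S [set x | Q x] -> S [set x | P x -> Q x].
Proof.
move=> hP hQ; have := sa_or (sa_not hP) hQ.
by congr S; apply/seteqP; split=> x /=; have := EM (P x); tauto.
Qed.

Lemma sa_and (P Q : T -> Prop) :
  S [set x | P x] -> S [set x | Q x] -> S [set x | P x /\ Q x].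
Proof.
move=> hP hQ; have := sa_not (sa_or (sa_not hP) (sa_not hQ)).
by congr S; apply/seteqP; split=> x /=; have := EM (P x); have := EM (Q x); tauto.
Qed.

Lemma sa_eqb (p q : T -> bool) :
  S [set x | p x] -> S [set x | q x] -> S [set x | p x = q x].
Proof.
move=> hp hq; have := sa_and (sa_imp hp hq) (sa_imp hq hp).
congr S; apply/seteqP; split=> x /=; last by move=> ->.
by case: (p x); case: (q x) => //= -[h1 h2]; [have := h1 isT|have := h2 isT].
Qed.

End sigma_algebra_predicates.

(** * The colouring *)

(* Ordering the differences by [r + k] and then by [r] makes the first one
   depend on finitely many bits only. *)
Definition first_diff (x y : bits) (q r k : nat) : Prop :=
  [/\ q <= r, x r k != y r k &
      forall r' k', q <= r' -> x r' k' != y r' k' ->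
        r + k < r' + k' \/ (r + k = r' + k' /\ r <= r')].

Definition jump (r k : nat) : nat := (r + k).+1.

Definition bad (x y : bits) (q : nat) : Prop :=
  exists r k r' k', [/\ first_diff x y q r k,
    first_diff x y (jump r k) r' k' & x r k != x r' k'].

Fixpoint reach_bad (i : nat) (x y : bits) (q : nat) : Prop :=
  if i is j.+1 then
    exists r k, first_diff x y q r k /\ reach_bad j x y (jump r k)
  else bad x y q.

Definition colour (x y : bits) : Prop :=
  exists K, forall n, K <= n -> exists i, reach_bad i x y n.

Lemma first_diff_ex x y q r0 k0 :
  q <= r0 -> x r0 k0 != y r0 k0 ->
  exists r k, first_diff x y q r k /\ r + k <= r0 + k0.
Proof.
move=> qr0 xy0.
pose P t := `[< exists r k, [/\ q <= r, x r k != y r k & r + k = t] >].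
have Pex : exists t, P t by exists (r0 + k0); apply/asboolP; exists r0, k0.
case: (ex_minnP Pex) => t /asboolP[r1 [k1 [qr1 xy1 <-]]] tmin.
(* Among the places with minimal sum, search for the least row; the column is then determined. *)
pose Q r := [&& q <= r, r <= r1 + k1 & x r (r1 + k1 - r) != y r (r1 + k1 - r)].
have Qex : exists r, Q r by exists r1; rewrite /Q qr1 leq_addr addKn.
case: (ex_minnP Qex) => r /and3P[qr rt xy] rmin.
exists r, (r1 + k1 - r); rewrite subnKC//; split.
  split=> // r' k' qr' xy'; rewrite subnKC//.
  have : r1 + k1 <= r' + k' by apply: tmin; apply/asboolP; exists r', k'.
  rewrite leq_eqVlt => /orP[/eqP e|]; [right|by left].
  by split=> //; apply: rmin; rewrite /Q qr' e leq_addr addKn.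
by apply: tmin; apply/asboolP; exists r0, k0.
Qed.

Lemma first_diff_uniq x y q r k r' k' :
  first_diff x y q r k -> first_diff x y q r' k' -> r = r' /\ k = k'.
Proof.
by move=> [qr xy h] [qr' xy' h']; have := h _ _ qr' xy'; have := h' _ _ qr xy; lia.
Qed.

Lemma first_diff_sym x y q r k : first_diff x y q r k -> first_diff y x q r k.
Proof.
move=> [qr xy h]; split=> // [|r' k' qr' xy']; first by rewrite eq_sym.
by apply: h; rewrite // eq_sym.
Qed.

Lemma first_diff_eqfrom N x y x' y' q r k :
  eqfrom N x x' -> eqfrom N y y' -> N <= q ->
  first_diff x y q r k -> first_diff x' y' q r k.
Proof.
move=> hx hy Nq [qr xy h]; split=> //; first by rewrite -hx -?hy//; lia.
by move=> r' k' qr'; rewrite -hx -?hy; [exact: h|lia..].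
Qed.

(** Places outside the [M] by [M] square have sum at least [M], so they cannot precede [(r, k)]. *)
Lemma first_diff_agree M x y x' y' q r k :
  agree M x x' -> agree M y y' -> r + k < M ->
  first_diff x y q r k -> first_diff x' y' q r k.
Proof.
move=> hx hy rkM [qr xy h]; split=> //; first by rewrite -hx -?hy//; lia.
move=> r' k' qr' xy'; have [|rkM'] := leqP M (r' + k'); first by lia.
by apply: h => //; rewrite hx ?hy//; lia.
Qed.

(** At a place of difference [y] carries the sign opposite to that of [x], so the exchange negates
    both signs. *)
Lemma bad_sym x y q : bad x y q -> bad y x q.
Proof.
move=> [r [k [r' [k' [f f' d]]]]]; exists r, k, r', k'.
split; [exact: first_diff_sym..|].
case: f f' d => _ + _ [_ + _].
by case: (x r k); case: (x r' k'); case: (y r k); case: (y r' k').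
Qed.

Lemma reach_bad_sym i x y q : reach_bad i x y q -> reach_bad i y x q.
Proof.
elim: i q => [|i ih] q /=; first exact: bad_sym.
by move=> [r [k [f b]]]; exists r, k; split; [exact: first_diff_sym|exact: ih].
Qed.

Lemma colour_sym x y : colour x y -> colour y x.
Proof.
by move=> [K h]; exists K => n /h[i b]; exists i; exact: reach_bad_sym.
Qed.

(** A chain of jumps from [q] reads only rows from [q] on. *)
Lemma reach_bad_eqfrom N i x y x' y' q :
  eqfrom N x x' -> eqfrom N y y' -> N <= q ->
  reach_bad i x y q -> reach_bad i x' y' q.
Proof.
move=> hx hy; elim: i q => [|i ih] q Nq /=.
  move=> [r [k [r' [k' [f f' d]]]]]; exists r, k, r', k'.
  have [qr _ _] := f; have [qr' _ _] := f'.
  have Nj : N <= jump r k by rewrite /jump; lia.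
  split; [exact: (first_diff_eqfrom hx hy _ f)|exact: (first_diff_eqfrom hx hy _ f')|].
  by rewrite -!hx//; move: Nj qr'; lia.
move=> [r [k [f b]]]; exists r, k; split; first exact: (first_diff_eqfrom hx hy _ f).
by apply: ih b; case: f => qr _ _; rewrite /jump; lia.
Qed.

Lemma colour_eqfrom N N' x y x' y' :
  eqfrom N x x' -> eqfrom N' y y' -> colour x y -> colour x' y'.
Proof.
move=> hx hy [K h]; exists (maxn K (maxn N N')) => n Kn.
have [|i b] := h n; first by lia.
exists i; apply: (@reach_bad_eqfrom (maxn N N')) b; last by lia.
  by apply: eqfrom_le hx; lia.
by apply: eqfrom_le hy; lia.
Qed.

(* The rows of [x] and [y] last differ in row [s.-1], the digits of index below
   [M] witness this, and the rows in the block [sp, s) are so close to each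
   other that every jump from the block leaves it. *)
Definition block (x y : bits) (sp s M : nat) : Prop :=
  [/\ s <= M, eqfrom s x y,
      exists k, x s.-1 k != y s.-1 k /\ s.-1 + k < M &
      forall r k, sp <= r -> r + k < s -> x r k = y r k].

Lemma block_first_diff x y sp s M q : block x y sp s M -> q < s ->
  exists r k, first_diff x y q r k /\ r + k < M.
Proof.
move=> [_ _ [k0 [d dM]] _] qs.
have [|r [k [f rk]]] := @first_diff_ex x y q s.-1 k0 _ d; first by lia.
by exists r, k; split=> //; lia.
Qed.

Lemma block_jump x y sp s M q r k : block x y sp s M -> sp <= q ->
  first_diff x y q r k -> s <= r + k.
Proof.
move=> [_ _ _ h] spq [qr d _]; rewrite leqNgt; apply: contraNN d => rks.
by rewrite h//; lia.
Qed.

Fixpoint reach (j : nat) (x y : bits) (n p : nat) : Prop :=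
  if j is i.+1 then
    exists r k, first_diff x y n r k /\ reach i x y (jump r k) p
  else n = p.

Lemma reach_le j x y n p : reach j x y n p -> n <= p.
Proof.
elim: j n => [n -> //|j ih] n [r [k [[nr _ _] /ih]]]; rewrite /jump; lia.
Qed.

Lemma reach_agree M j x y x' y' n p : agree M x x' -> agree M y y' -> p <= M ->
  reach j x y n p -> reach j x' y' n p.
Proof.
move=> hx hy pM; elim: j n => [//|j ih] n [r [k [f h]]].
exists r, k; split; last exact: ih.
by apply: first_diff_agree hx hy _ f; have := reach_le h; rewrite /jump; lia.
Qed.

Lemma reachS j x y n p r k : reach j x y n p -> first_diff x y p r k ->
  reach j.+1 x y n (jump r k).
Proof.
elim: j n => [n -> f|j ih n [r' [k' [f h]]] f']; first by exists r, k.
by exists r', k'; split=> //; exact: ih.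
Qed.

Lemma reach_reach_bad j x y n p : reach j x y n p -> bad x y p -> reach_bad j x y n.
Proof.
elim: j n => [n -> //|j ih] n [r [k [f h]]] b.
by exists r, k; split=> //; exact: ih.
Qed.

(** * Borel measurability of the colouring *)

Lemma borel_sigma_algebra (X : topologicalType) : sigma_algebra setT (@borel_set X).
Proof. exact: smallest_sigma_algebra. Qed.

Lemma bit_continuous n m : continuous (fun x : cantor_seq => x n m : bool).
Proof.
move=> x; have c1 : continuous (fun x : cantor_seq => x n).
  exact: (@proj_continuous nat (fun _ => cantor_space) n).
have c2 : continuous (fun y : cantor_space => y m : bool).
  exact: (@proj_continuous nat (fun _ => bool) m).
exact: (continuous_comp (c1 x) (c2 (x n))).
Qed.

Lemma borel_preimage_bool (X : topologicalType) (g : X -> bool) :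
  continuous g -> borel_set [set x | g x].
Proof.
move=> gc; apply: borel_set_open.
apply: (@open_comp _ _ g [set true]); first by move=> x _; exact: gc.
exact: discrete_open.
Qed.

Lemma borel_colour :
  borel_set [set p : cantor_seq * cantor_seq | colour p.1 p.2].
Proof.
pose X : topologicalType := (cantor_seq * cantor_seq)%type.
have S := borel_sigma_algebra X.
have b1 n m : borel_set [set p : X | p.1 n m].
  apply: borel_preimage_bool => p.
  exact: (continuous_comp (@cvg_fst _ _ _ _ _) (@bit_continuous n m p.1)).
have b2 n m : borel_set [set p : X | p.2 n m].
  apply: borel_preimage_bool => p.
  exact: (continuous_comp (@cvg_snd _ _ _ _ _) (@bit_continuous n m p.2)).
have bD n m : borel_set [set p : X | p.1 n m != p.2 n m].
  have := sa_not S (sa_eqb S (b1 n m) (b2 n m)).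
  by congr borel_set; apply/seteqP; split=> p /= /eqP.
have bF q r k : borel_set [set p : X | first_diff p.1 p.2 q r k].
  have := sa_and S (sa_cst S (q <= r)) (sa_and S (bD r k)
    (sa_all S (fun r' => sa_all S (fun k' => sa_imp S (sa_cst S (q <= r'))
      (sa_imp S (bD r' k')
        (sa_cst S (r + k < r' + k' \/ r + k = r' + k' /\ r <= r'))))))).
  congr borel_set; apply/seteqP; split=> p /=; first by move=> [? [? ?]].
  by move=> [? ? ?].
have bB q : borel_set [set p : X | bad p.1 p.2 q].
  apply: (sa_ex S) => r; apply: (sa_ex S) => k.
  apply: (sa_ex S) => r'; apply: (sa_ex S) => k'.
  have := sa_and S (bF q r k) (sa_and S (bF (jump r k) r' k')
    (sa_not S (sa_eqb S (b1 r k) (b1 r' k')))).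
  congr borel_set; apply/seteqP; split=> p /=.
    by move=> [? [? /eqP ?]].
  by move=> [? ? /eqP ?].
have bR i q : borel_set [set p : X | reach_bad i p.1 p.2 q].
  elim: i q => [|i ih] q; first exact: bB.
  apply: (sa_ex S) => r; apply: (sa_ex S) => k.
  exact: (sa_and S (bF q r k) (ih (jump r k))).
apply: (sa_ex S) => K; apply: (sa_all S) => n; apply: (sa_imp S).
  exact: (sa_cst S).
by apply: (sa_ex S) => i; exact: bR.
Qed.

(** * Generic points of a reduction *)

Lemma baire_flip (B : set bits) g : baire B -> baire [set w | B (flip g w)].
Proof.
move=> [G rG hB]; exists (fun w => forall h, G (flip h w)); first exact: residual_flip.
move=> w Gw; have [l hl] := hB _ (Gw g).
by exists l => y Gy wy; apply: hl => //; exact: agree_flip.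
Qed.

Lemma baire_generic (J : countType) (B : J -> set bits) :
  (forall j, baire (B j)) ->
  exists G, [/\ residual G, forall w g, G w -> G (flip g w) &
                forall j, rel_clopen G (B j)].
Proof.
move=> hB; have /choice[F hF] j : exists G, residual G /\ rel_clopen G (B j).
  by have [G rG h] := hB j; exists G.
(* Intersecting over all flips, of which there are countably many, makes the residual set
   invariant. *)
exists (fun w => forall g j, F j (flip g w)); split.
- apply: (@residual_flip (fun w => forall j, F j w)).
  by apply: residual_forall => j; have [] := hF j.
- by move=> w g h g' j; rewrite -flip_cat.
- move=> j; apply: rel_clopenS (hF j).2 => w /(_ [::] j).
  by rewrite flip0.
Qed.

Lemma uniform_bound (P : nat -> nat -> Prop) :
  (forall i l l', l <= l' -> P i l -> P i l') -> (forall i, exists l, P i l) ->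
  forall M, exists l, forall i, i < M -> P i l.
Proof.
move=> Pmono hP; elim=> [|M [l hl]]; first by exists 0.
have [l' hl'] := hP M; exists (maxn l l') => i.
rewrite ltnS leq_eqVlt => /orP[/eqP->|iM].
  by apply: Pmono hl'; exact: leq_maxr.
by apply: Pmono (hl i iM); exact: leq_maxl.
Qed.

(** Each step can be made without disturbing a given square. A larger square is then fixed that
    secures the next open dense set for both limits and the open condition [O]. *)
Lemma fusion (G : bits -> Prop) (T : Type) (u v : T -> bits)
    (I : nat -> T -> Prop)
    (R : nat -> T -> T -> Prop) (O : nat -> T -> bits -> bits -> Prop) (t0 : T) :
  residual G ->
  (forall i t, I i t -> G (u t) /\ G (v t)) ->
  (forall i t l, I i t -> exists t', [/\ I i.+1 t', agree l (u t) (u t'),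
     agree l (v t) (v t') & R i t t']) ->
  (forall i t t', I i.+1 t' -> R i t t' -> exists l, forall y z, G y -> G z ->
     agree l (u t') y -> agree l (v t') z -> O i t' y z) ->
  I 0 t0 ->
  exists F : nat -> T, exists y z, [/\ F 0 = t0, G y, G z &
    forall i, [/\ I i (F i), R i (F i) (F i.+1), O i (F i.+1) y z,
      agree i (u (F i)) y & agree i (v (F i)) z]].
Proof.
move=> [W [hW GW]] IG Istep Ropen It0.
(* Guarding by the invariant makes the relation total, as dependent choice requires. *)
pose Q (s t : T * nat * nat) := I s.2 s.1.1 ->
  [/\ I s.2.+1 t.1.1, R s.2 s.1.1 t.1.1, t.2 = s.2.+1, s.1.2 < t.1.2 &
   [/\ agree s.1.2 (u s.1.1) (u t.1.1), agree s.1.2 (v s.1.1) (v t.1.1),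
       forall y, agree t.1.2 (u t.1.1) y -> W s.2 y,
       forall y, agree t.1.2 (v t.1.1) y -> W s.2 y &
       forall y z, G y -> G z -> agree t.1.2 (u t.1.1) y ->
         agree t.1.2 (v t.1.1) z -> O s.2 t.1.1 y z]].
have [|f [f0 fS]] := @dependent_choice _ Q _ (t0, 0, 0).
  move=> [[t l] i]; apply/cid.
  have [It|nIt] := pselect (I i t); last by exists (t, 0, 0) => /nIt.
  have [t' [It' ut vt Rt]] := Istep i t l It.
  have [Gu Gv] := IG _ _ It'.
  have [l1 h1] := (hW i).1 _ ((GW _).1 Gu i).
  have [l2 h2] := (hW i).1 _ ((GW _).1 Gv i).
  have [l3 h3] := Ropen _ _ _ It' Rt.
  pose l' := maxn l.+1 (maxn l1 (maxn l2 l3)).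
  have e1 : l1 <= l' by rewrite /l'; lia.
  have e2 : l2 <= l' by rewrite /l'; lia.
  have e3 : l3 <= l' by rewrite /l'; lia.
  exists (t', l', i.+1) => _; split => //=; first by rewrite /l'; lia.
  split=> // [y /(agree_le e1)/h1|y /(agree_le e2)/h2|]//.
  by move=> y z Gy Gz /(agree_le e3) uy /(agree_le e3) vz; exact: h3.
have /all_and2[If fi] i : I i (f i).1.1 /\ (f i).2 = i.
  elim: i => [|i [ih e]]; first by rewrite f0.
  by case: (fS i); rewrite e // => ? ? ->.
have IS i : I (f i).2 (f i).1.1 by rewrite fi.
have lS i : (f i).1.2 < (f i.+1).1.2 by case: (fS i (IS i)).
have li i : i <= (f i).1.2 by elim: i => // i ih; exact: leq_ltn_trans ih (lS i).
have [|y hy] := @limit_agree (fun i => u (f i).1.1) _ lS.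
  by move=> i; case: (fS i (IS i)) => _ _ _ _ [].
have [|z hz] := @limit_agree (fun i => v (f i).1.1) _ lS.
  by move=> i; case: (fS i (IS i)) => _ _ _ _ [].
have Gy : G y.
  apply/GW => i; have [_ _ _ _ [_ _ h _ _]] := fS i (IS i).
  by rewrite -[i]fi; apply: h; exact: hy.
have Gz : G z.
  apply/GW => i; have [_ _ _ _ [_ _ _ h _]] := fS i (IS i).
  by rewrite -[i]fi; apply: h; exact: hz.
exists (fun i => (f i).1.1), y, z; split=> //; first by rewrite f0.
move=> i; have [_ Ri _ _ [_ _ _ _ h]] := fS i (IS i); rewrite fi in Ri h.
split=> //; first exact: h.
  exact: agree_le (hy i).
exact: agree_le (hz i).
Qed.

(** * Effect of flips on the image under a reduction *)

Section reduction.
Variable phi : bits -> bits.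
Hypothesis phi_baire : forall n m, baire [set w | phi w n m].
Hypothesis phi_hom : forall u v,
  (exists N, eqfrom N u v) -> exists N, eqfrom N (phi u) (phi v).
Hypothesis phi_inj : forall u v,
  (exists N, eqfrom N (phi u) (phi v)) -> exists N, eqfrom N u v.

Definition unbounded (k : nat) (w : bits) : Prop :=
  forall N L, exists e n m,
    [/\ L <= e, N <= n & phi (flip [:: (k, e)] w) n m != phi w n m].

Record generic (G : bits -> Prop) : Prop := Generic {
  generic_residual : residual G;
  generic_flip : forall w g, G w -> G (flip g w);
  generic_bit : forall n m, rel_clopen G (fun w => phi w n m);
  generic_eqfrom : forall g N,
    rel_clopen G (fun w => eqfrom N (phi w) (phi (flip g w)));
  generic_unbounded : forall k, rel_clopen G (unbounded k) }.

Lemma generic_ex : exists G, generic G.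
Proof.
have S := baire_sigma_algebra.
have beq g n m : baire [set w | phi w n m = phi (flip g w) n m].
  by apply: (sa_eqb S) => //; exact: (baire_flip g (phi_baire n m)).
have [|] := @baire_generic ((nat * nat) + (seq (nat * nat) * nat + nat))%type
  (fun j => match j with
    | inl (n, m) => [set w | phi w n m]
    | inr (inl (g, N)) => [set w | eqfrom N (phi w) (phi (flip g w))]
    | inr (inr k) => [set w | unbounded k w] end).
  case=> [[n m]//|[[g N]|k]].
    apply: (sa_all S) => n; apply: (sa_all S) => m.
    by apply: (sa_imp S) => //; exact: (sa_cst S).
  apply: (sa_all S) => N; apply: (sa_all S) => L; apply: (sa_ex S) => e.
  apply: (sa_ex S) => n; apply: (sa_ex S) => m.
  have := sa_and S (sa_cst S (L <= e)) (sa_and S (sa_cst S (N <= n))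
    (sa_not S (beq [:: (k, e)] n m))).
  congr baire; apply/seteqP; split=> w /=; first by move=> [? [? /eqP]]; rewrite eq_sym.
  by move=> [? ?]; rewrite eq_sym => /eqP.
move=> G [rG Gf GB]; exists G; split=> //.
- by move=> n m; exact: (GB (inl (n, m))).
- by move=> g N; exact: (GB (inr (inl (g, N)))).
- by move=> k; exact: (GB (inr (inr k))).
Qed.

Section generic.
Variables (G : bits -> Prop).
Hypothesis gG : generic G.

Lemma generic_agree u M : G u ->
  exists l, forall w, G w -> agree l u w -> agree M (phi u) (phi w).
Proof.
move=> Gu.
have [||l hl] := @uniform_bound (fun n l => forall m, m < M ->
  forall w, G w -> agree l u w -> phi u n m = phi w n m) _ _ M.
- by move=> n l l' ll h m mM w Gw /(agree_le ll); exact: h.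
- move=> n; apply: uniform_bound => [m l l' ll h w Gw /(agree_le ll)|m]; first exact: h.
  have [l hl] := generic_bit gG n m Gu; exists l => w Gw uw.
  by apply/idP/idP; apply hl.
- by exists l => w Gw uw n m nM mM; exact: hl.
Qed.

(* If unboundedly long changes could be produced by flipping a single bit of
   row [k], accumulating such flips would produce infinitely many changes in
   [phi] while changing only row [k]. *)
Lemma generic_bounded a k : G a -> ~ unbounded k a.
Proof.
move=> Ga Ba; have [l0 hl0] := generic_unbounded gG k Ga.
pose I (i : nat) w := [/\ G w, agree l0 a w & forall n m, n <> k -> a n m = w n m].
pose R i (_ w : bits) := exists n m, i <= n /\ phi w n m != phi a n m.
pose O i (_ y z : bits) := exists n m, i <= n /\ phi y n m != phi a n m.
have [||||F [y [z [_ Gy _ H]]]] := @fusion G _ id id I R O a (generic_residual gG).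
- by move=> i w [].
- move=> i w l [Gw aw eqk].
  have [N hN] : exists N, eqfrom N (phi a) (phi w).
    by apply: phi_hom; exists k.+1 => n m kn; apply: eqk; lia.
  (* From row [N] on [phi w] equals [phi a], so a change there is also one relative to [phi a]. *)
  have [e [n [m [le Nn d]]]] := (hl0 w Gw aw).1 Ba (maxn N i) (maxn l l0).
  exists (flip [:: (k, e)] w); split.
  + split; [exact: generic_flip| |].
      by apply: agree_trans aw (agree_flip1 _ _ _); lia.
    by move=> n' m' nk; rewrite flip1E eqk//; case: eqP => // _; rewrite addbF.
  + by apply: agree_flip1; lia.
  + by apply: agree_flip1; lia.
  + exists n, m; split; first by lia.
    by rewrite hN//; lia.
- move=> i _ w [Gw _ _] [n [m [ni d]]].
  have [l hl] := generic_bit gG n m Gw; exists l => y z Gy _ wy _.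
  exists n, m; split=> //; suff -> : phi y n m = phi w n m by [].
  by apply/idP/idP; apply hl.
- by split.
have [N hN] : exists N, eqfrom N (phi a) (phi y).
  apply: phi_hom; exists k.+1 => n m kn.
  have [[_ _ eqk] _ _ h _] := H (maxn n m).+1.
  by rewrite (eqk n m); [apply: h; lia|lia].
have [_ _ [n [m [Nn d]]] _ _] := H N.
by rewrite hN// eqxx in d.
Qed.

(* Otherwise one could flip one bit in every row of [a] without changing
   [phi a] beyond row [N]. *)
Lemma generic_loud a l N : G a -> exists w k, [/\ G w, agree l a w &
  forall L, exists e n m, [/\ L <= e, N <= n &
    phi (flip [:: (k, e)] w) n m != phi w n m]].
Proof.
move=> Ga; apply: contrapT => quiet.
pose I i w := [/\ G w, agree l a w, eqfrom N (phi a) (phi w) &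
  forall n m, i <= n -> a n m = w n m].
pose R i (_ w : bits) := exists m, w i m != a i m.
pose O i (_ y z : bits) := exists m, y i m != a i m.
have [||||F [y [z [_ Gy _ H]]]] := @fusion G _ id id I R O a (generic_residual gG).
- by move=> i w [].
- move=> i w l' [Gw aw pw wa].
  (* Since [w] with row [i] is no witness, late flips in that row leave the image alone from row [N]
     on. *)
  have [L hL] : exists L, forall e n m, L <= e -> N <= n ->
      phi (flip [:: (i, e)] w) n m = phi w n m.
    apply: contrapT => nL; apply: quiet; exists w, i; split=> // L.
    apply: contrapT => nL'; apply: nL; exists L => e n m Le Nn.
    by apply/eqP; apply/negPn/negP => d; apply: nL'; exists e, n, m.
  pose e := maxn (maxn l l') L.
  exists (flip [:: (i, e)] w); split.
  + split; [exact: generic_flip| | |].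
    * by apply: agree_trans aw (agree_flip1 _ _ _); rewrite /e; lia.
    * by move=> n m Nn; rewrite hL ?pw// /e; lia.
    * move=> n m jn; rewrite flip1E wa; last by lia.
      by rewrite (gtn_eqF jn) addbF.
  + by apply: agree_flip1; rewrite /e; lia.
  + by apply: agree_flip1; rewrite /e; lia.
  + by exists e; rewrite flip1E !eqxx wa//; case: (w i e).
- move=> i _ w _ [m d]; exists (maxn i m).+1 => y z _ _ wy _.
  by exists m; rewrite -wy//; lia.
- by split.
have [K hK] : exists K, eqfrom K a y.
  (* Equality from row [N] on passes to the limit by continuity of [phi] on [G]. *)
  apply: phi_inj; exists N => n m Nn.
  have [l' hl'] := generic_agree (maxn n m).+1 Gy.
  have [[Gw _ pw _] _ _ /agree_sym wy _] := H l'.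
  by rewrite pw// (hl' _ Gw wy)//; lia.
have [_ _ [m d] _ _] := H K.
by rewrite hK// eqxx in d.
Qed.


(** [w1] is [w0] with one bit flipped. [generic_loud] puts a change of the image at row [N] or
    later, and [generic_bounded] provides a last changed row [d]. One [h] serves both pairs
    [(w0, flip g w1)] and [(w1, flip g w0)]. *)
Lemma generic_split u g s N l :
  G u -> eqfrom s (phi u) (phi (flip g u)) ->
  exists w0 w1 h d, [/\ [/\ G w0, agree l u w0, flip h w0 = flip g w1 &
      eqfrom s (phi w0) (phi (flip g w0))],
    [/\ G w1, agree l u w1, flip h w1 = flip g w0 &
      eqfrom s (phi w1) (phi (flip g w1))] &
    [/\ N <= d, eqfrom d.+1 (phi w0) (phi w1),
      exists k, phi w0 d k != phi w1 d k &
      forall r k, r + k <= d -> phi w0 r k = phi w1 r k]].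
Proof.
move=> Gu Zu; have [l1 hl1] := generic_eqfrom gG g s Gu.
have [w [k [Gw uw loud]]] := @generic_loud u (maxn l l1) N Gu.
have [N' [L bounded]] : exists N' L, forall e n m, L <= e -> N' <= n ->
    phi (flip [:: (k, e)] w) n m = phi w n m.
  apply: contrapT => nb; apply: (@generic_bounded w k Gw) => N' L.
  apply: contrapT => nb'; apply: nb; exists N', L => e n m Le Nn.
  by apply/eqP; apply/negPn/negP => d; apply: nb'; exists e, n, m.
have [l2 hl2] := generic_agree N' Gw.
(* Past [L] only rows below [N'] can change, and past [l2] the first [N'] digits of those rows do
   not. *)
have [e [n [m [le Nn d]]]] := loud (maxn (maxn l l1) (maxn L l2)).
pose w' := flip [:: (k, e)] w.
have Gw' : G w' by exact: generic_flip.
have ww' : agree (maxn (maxn l l1) l2) w w' by apply: agree_flip1; lia.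
have uw' : agree (maxn l l1) u w' by apply: agree_trans uw (agree_le _ ww'); lia.
have pww' : agree N' (phi w) (phi w') by apply: hl2 => //; apply: agree_le ww'; lia.
have Zw v : G v -> agree (maxn l l1) u v -> eqfrom s (phi v) (phi (flip g v)).
  by move=> Gv uv; apply/(hl1 v Gv) => //; apply: agree_le uv; lia.
pose P i := `[< exists j, phi w i j != phi w' i j >].
have Pex : exists i, P i by exists n; apply/asboolP; exists m; rewrite eq_sym.
have PN i : P i -> i <= N'.
  move=> /asboolP[j]; apply: contraNT => iN; rewrite /w' bounded//; lia.
case: (ex_maxnP Pex PN) => i /asboolP[j dij] imax.
exists w, w', (g ++ [:: (k, e)]), i; rewrite !flip_cat flipK; split.
- by split=> //; [apply: agree_le uw; lia|exact: Zw].
- by split=> //; [apply: agree_le uw'; lia|exact: Zw].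
- split.
  + apply: leq_trans Nn (imax _ _); apply/asboolP; exists m; by rewrite eq_sym.
  + move=> n' m' i_n'; apply/eqP; apply: contraLR i_n' => d'; rewrite -leqNgt.
    by apply: imax; apply/asboolP; exists m'.
  + by exists j.
  + have iN : i < N'.
      rewrite ltnNge; apply: contraNN dij => Ni; rewrite /w' bounded//; lia.
    by move=> r c rc; apply: pww'; lia.
Qed.

(* Exchanging [w0] and [w1] exchanges the two sides of the pair beyond row [s],
   so that the sign of the new block can be prescribed. *)
Lemma generic_extend u g sp s M q b l :
  G u -> block (phi u) (phi (flip g u)) sp s M -> sp <= q -> q < s ->
  exists u' g' s' M', [/\ G u', agree l u u' /\ agree l (flip g u) (flip g' u'),
    agree M (phi u) (phi u') /\ agree M (phi (flip g u)) (phi (flip g' u')),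
    block (phi u') (phi (flip g' u')) s s' M' /\ M < s' &
    exists r k r' k', [/\ first_diff (phi u') (phi (flip g' u')) q r k,
      first_diff (phi u') (phi (flip g' u')) (jump r k) r' k',
      r + k < M, r' + k' < M' & phi u' r k (+) phi u' r' k' = b]].
Proof.
move=> Gu blk spq qs; have [sM Zu _ _] := blk.
have [r [k [f rkM]]] := block_first_diff blk qs.
have srk := block_jump blk spq f.
have [l1 hl1] := generic_agree M Gu.
have [l2 hl2] := generic_agree M (generic_flip gG g Gu).
have [w0 [w1 [h [d [W0 W1 [Md eq01 [k0 d01] close]]]]]] :=
  @generic_split u g s M (maxn l (maxn l1 l2)) Gu Zu.
(* Either order of [w0] and [w1] is a valid extension; from row [s] on its two images are [phi wa]
   and [phi wb]. *)
have opt wa wb : [/\ G wa, agree (maxn l (maxn l1 l2)) u wa, flip h wa = flip g wb &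
      eqfrom s (phi wa) (phi (flip g wa))] ->
    [/\ G wb, agree (maxn l (maxn l1 l2)) u wb, flip h wb = flip g wa &
      eqfrom s (phi wb) (phi (flip g wb))] ->
    eqfrom d.+1 (phi wa) (phi wb) -> phi wa d k0 != phi wb d k0 ->
    (forall r k, r + k <= d -> phi wa r k = phi wb r k) ->
    [/\ agree l u wa /\ agree l (flip g u) (flip h wa),
      agree M (phi u) (phi wa) /\ agree M (phi (flip g u)) (phi (flip h wa)),
      block (phi wa) (phi (flip h wa)) s d.+1 (d + k0).+1 &
      eqfrom s (phi wb) (phi (flip h wa))].
  move=> [Ga ua ha Za] [Gb ub _ Zb] ab dab cl.
  have e1 : l <= maxn l (maxn l1 l2) by lia.
  have e2 : l1 <= maxn l (maxn l1 l2) by lia.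
  have e3 : l2 <= maxn l (maxn l1 l2) by lia.
  rewrite ha; split=> //.
  - split; first exact: agree_le ua.
    by apply: agree_flip; exact: agree_le ub.
  - split; first by apply: hl1 => //; exact: agree_le ua.
    by apply: hl2; [exact: generic_flip|apply: agree_flip; exact: agree_le ub].
  - split=> /=; [lia| | |].
    + by apply: eqfrom_trans ab (eqfrom_le _ Zb); lia.
    + by exists k0; rewrite -Zb//; lia.
    + by move=> r0 c0 sr0 rc0; rewrite -Zb// cl.
have [A1 A2 A3 A4] := opt w0 w1 W0 W1 eq01 d01 close.
have [|r1 c1 e|B1 B2 B3 B4] := opt w1 w0 W1 W0 (eqfrom_sym eq01).
- by rewrite eq_sym.
- by rewrite close.
have [|r' [k' [f' rkM']]] := @block_first_diff _ _ _ _ _ (jump r k) A3.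
  by rewrite /jump; lia.
have [sr' dr' _] := f'.
have sj : s <= jump r k by rewrite /jump; lia.
have [G0 _ e0 Z0] := W0; have [G1 _ e1 Z1] := W1.
have [E|E] := eqVneq (phi u r k (+) phi w0 r' k') b.
  exists w0, h, d.+1, (d + k0).+1; split=> //.
  exists r, k, r', k'; split=> //; first by apply: first_diff_agree A2.1 A2.2 _ f.
  by rewrite -A2.1//; lia.
(* The sign at [(r, k)] lies in the preserved square, so only the one at [(r', k')] is reversed. *)
exists w1, h, d.+1, (d + k0).+1; split=> //.
exists r, k, r', k'; split=> //; first by apply: first_diff_agree B2.1 B2.2 _ f.
  by apply: (first_diff_eqfrom (eqfrom_sym A4) B4 sj); exact: first_diff_sym.
rewrite -B2.1; [|lia|lia].
rewrite A4; last by move: sj sr'; lia.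
move: E dr'; case: (phi u r k); case: (phi w0 r' k');
  by case: (phi (flip h w0) r' k'); case: b.
Qed.

(** Iterates the extension by fusion. For [b] false the rows [q i] form a single chain of jumps
    without sign change. For [b] true the sign changes after each [q i], and row [i] leads to
    [q i.+1] because chains started before the end of a block enter it. *)
Lemma generic_pair (b : bool) : exists u v (q : nat -> nat), forall i,
  i <= q i /\
  exists r k r' k', [/\ first_diff (phi u) (phi v) (q i) r k,
    first_diff (phi u) (phi v) (jump r k) r' k',
    phi u r k (+) phi u r' k' = b &
    if b then exists j, reach j (phi u) (phi v) i (q i.+1)
    else q i.+1 = jump r k].
Proof.
pose T := (bits * seq (nat * nat) * (nat * nat * nat * nat))%type.
pose U (t : T) := t.1.1; pose V (t : T) := flip t.1.2 t.1.1.
pose X t := phi (U t); pose Y t := phi (V t).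
pose sp (t : T) := t.2.1.1.1; pose s (t : T) := t.2.1.1.2.
pose M (t : T) := t.2.1.2; pose q (t : T) := t.2.2.
pose I i t := [/\ G (U t), block (X t) (Y t) (sp t) (s t) (M t),
  sp t <= q t < s t, i <= sp t & forall n, n < s t ->
    exists p j, sp t <= p < s t /\ reach j (X t) (Y t) n p].
pose R i t t' := exists r k r' k', [/\ first_diff (X t') (Y t') (q t) r k,
  first_diff (X t') (Y t') (jump r k) r' k', r + k < M t' /\ r' + k' < M t',
  X t' r k (+) X t' r' k' = b &
  if b then exists j, reach j (X t') (Y t') i (q t') else q t' = jump r k].
pose O (i : nat) t y z := agree (M t) (X t) (phi y) /\ agree (M t) (Y t) (phi z).
have [w Gw] := residual_nonempty (generic_residual gG).
(* Splitting with the empty modification yields the first block, which starts at row 0. *)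
have Z0 : eqfrom 0 (phi w) (phi (flip [::] w)) by rewrite flip0.
have [w0 [w1 [h [d [[G0 _ e0 _] _ [_ eq01 [k0 d01] close]]]]]] :=
  @generic_split w [::] 0 0 0 Gw Z0.
rewrite flip0 in e0.
have blk0 : block (phi w0) (phi (flip h w0)) 0 d.+1 (d + k0).+1.
  rewrite e0; split=> /=; [lia|done|by exists k0|].
  by move=> r c _ rc; rewrite close.
have [||||F [y [z [_ _ _ H]]]] :=
  @fusion G T U V I R O (w0, h, (0, d.+1, (d + k0).+1, 0)) (generic_residual gG).
- by move=> i t [Gt _ _ _ _]; split=> //; exact: generic_flip.
- move=> i t l [Gt blk /andP[spq qs] isp cov].
  have [sM _ _ _] := blk.
  have [u' [g' [s' [M' [Gu' [uu vv] [xx yy] [blk' Ms']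
      [r [k [r' [k' [f f' rkM rkM' sgn]]]]]]]]]] :=
    @generic_extend (U t) t.1.2 (sp t) (s t) (M t) (q t) b l Gt blk spq qs.
  have [sM' _ _ _] := blk'.
  (* From an older row the chain enters the previous block; one more jump leaves it and lands at
     most at [M t < s']. *)
  have cov' n : n < s' ->
      exists p j, s t <= p < s' /\ reach j (phi u') (phi (flip g' u')) n p.
    move=> ns'; have [ns|sn] := ltnP n (s t); last by exists n, 0; rewrite sn ns'.
    have [p [j [/andP[spp ps] rp]]] := cov n ns.
    have [r0 [c0 [f0 rc0]]] := block_first_diff blk ps.
    have := block_jump blk spp f0.
    exists (jump r0 c0), j.+1; split; first by rewrite /jump; lia.
    apply: reachS (first_diff_agree xx yy rc0 f0).
    by apply: reach_agree xx yy _ rp; lia.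
  (* For [b] false the chain continues; for [b] true any row of the new block reached from [i] will
     do. *)
  have [q' [q's Q]] : exists q', s t <= q' < s' /\
      if b then exists j, reach j (phi u') (phi (flip g' u')) i q' else q' = jump r k.
    case: (b); last first.
      exists (jump r k); split=> //.
      have [r0 [c0 [f0 rc0]]] := block_first_diff blk qs.
      have [<- <-] := first_diff_uniq (first_diff_agree xx yy rc0 f0) f.
      by have := block_jump blk spq f0; rewrite /jump; lia.
    by have [|p [j [sps rp]]] := cov' i; [lia|exists p; split=> //; exists j].
  exists (u', g', (s t, s', M', q')); split=> //.
    by split=> //; change (i < s t); lia.
  exists r, k, r', k'; split=> //; split=> //.
  by apply: leq_trans rkM _; change (M t <= M'); lia.
- move=> i t t' [Gt' _ _ _ _] _.
  have [l1 hl1] := generic_agree (M t') Gt'.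
  have [l2 hl2] := generic_agree (M t') (generic_flip gG t'.1.2 Gt').
  exists (maxn l1 l2) => y z Gy Gz uy vz.
  split; first by apply: hl1 => //; apply: agree_le uy; lia.
  by apply: hl2 => //; apply: agree_le vz; lia.
- by split=> // n nd; exists n, 0.
exists y, z, (fun i => q (F i)) => i.
have [[_ blk /andP[spq _] isp _] [r [k [r' [k' [f f' [rkM rkM'] sgn Q]]]]]
  [xx yy] _ _] := H i.
split; first by lia.
have [_ _ /andP[_ q's] _ _] : I i.+1 (F i.+1) by case: (H i.+1).
have sM : s (F i.+1) <= M (F i.+1) by case: (H i.+1) => -[_ []].
have b1 : X (F i.+1) r k = phi y r k by apply: xx; lia.
have b2 : X (F i.+1) r' k' = phi y r' k' by apply: xx; lia.
exists r, k, r', k'; split.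
- exact: first_diff_agree xx yy rkM f.
- exact: first_diff_agree xx yy rkM' f'.
- by rewrite -b1 -b2.
- move: Q; case: (b) => // -[j rj]; exists j.
  by apply: reach_agree xx yy _ rj; lia.
Qed.

End generic.

Lemma colour_pair (b : bool) : exists u v,
  (colour (phi u) (phi v) <-> b) /\ ~ exists N, eqfrom N (phi u) (phi v).
Proof.
have [G gG] := generic_ex; have [u [v [q h]]] := generic_pair gG b.
exists u, v; split; last first.
  move=> [N hN]; have [Nq [r [k [_ [_ [[qr d _] _ _ _]]]]]] := h N.
  by rewrite hN ?eqxx// in d; lia.
case: b h => h; split=> //.
  (* Row [n] reaches [q n.+1], and there the sign changes at the next jump. *)
  move=> _; exists 0 => n _; have [_ [_ [_ [_ [_ [_ _ _ [j rj]]]]]]] := h n.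
  exists j; apply: reach_reach_bad rj _.
  have [_ [r [k [r' [k' [f f' sgn _]]]]]] := h n.+1.
  by exists r, k, r', k'; split=> //; move: sgn; case: (phi u r k); case: (phi u r' k').
(* First differences being unique, the chain from [q K] runs through the later [q i] and meets no
   sign change. *)
move=> [K hK]; have [Kq _] := h K; have [i] := hK _ Kq.
elim: i K {hK Kq} => [|i ih] K /=; have [_ [r [k [r' [k' [f f' sgn qS]]]]]] := h K.
  move=> [r1 [k1 [r1' [k1' [f1 f1' d]]]]].
  have [er ek] := first_diff_uniq f f1; subst r1 k1.
  have [er' ek'] := first_diff_uniq f' f1'; subst r1' k1'.
  by move: d sgn; case: (phi u r k); case: (phi u r' k').
move=> [r1 [k1 [f1]]].
by have [<- <-] := first_diff_uniq f f1; rewrite -qS; exact: ih.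
Qed.

End reduction.

(** * Both colours on the image of a reduction *)

Theorem theorem3 : ~ borel_weakly_compact E1.
Proof.
move=> /(_ (fun p => `[< colour p.1 p.2 >])) [].
- move=> B _; have S := borel_sigma_algebra (cantor_seq * cantor_seq)%type.
  (* A preimage under a boolean map depends only on which of [true] and [false] lie in [B]. *)
  have := sa_and S (sa_imp S borel_colour (sa_cst S (B true)))
    (sa_imp S (sa_not S borel_colour) (sa_cst S (B false))).
  congr borel_set; apply/seteqP; split=> p /=.
    by move=> [h1 h2]; case: asboolP.
  by case: asboolP => c hB; split.
- by move=> x y; apply/asboolP/asboolP; exact: colour_sym.
- move=> x x' y y' /E1P[N hx] /E1P[N' hy]; apply/asboolP/asboolP => /=.
    exact: colour_eqfrom hx hy.
  exact: colour_eqfrom (eqfrom_sym hx) (eqfrom_sym hy).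
move=> A [_ [psi [psiB psiE]] [c hc]].
pose phi (x : cantor_seq) : cantor_seq := set_val (psi x).
have phiE u v : E1 u v <-> E1 (phi u) (phi v) by exact: psiE.
have phi_baire n m : baire [set w | phi w n m].
  apply: (@borel_baire (psi @^-1` [set x | (set_val x : cantor_seq) n m])).
  apply: psiB; apply: borel_preimage_bool => x.
  exact: (continuous_comp (@initial_continuous _ _ _ x) (@bit_continuous n m _)).
(* The pair is given the colour opposite to the supposed constant. *)
have [||u [v [huv nE]]] := @colour_pair phi phi_baire _ _ (~~ c).
- by move=> u v uv; exact: ((E1P _ _).1 ((phiE u v).1 ((E1P u v).2 uv))).
- by move=> u v uv; exact: ((E1P _ _).1 ((phiE u v).2 ((E1P _ _).2 uv))).
have := hc (phi u) (phi v) (set_valP (psi u)) (set_valP (psi v))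
  (fun e => nE ((E1P _ _).1 e)).
move: huv; case: asboolP => /= hcol [h1 h2] e; subst c; first by have := h1 hcol.
by case: hcol; exact: h2.
Qed.
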